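(* Let $R$ be an associative ring with identity. The following conditions are equivalent: (1) $R$ is perfect. (2) $\mathfrak{F}^{-1}(M)=\underline{\mathfrak{Pr}}^{-1}(M)$ for any left $R$-module $M$. (3) $\mathfrak{F}^{-1}(M)\subseteq\underline{\mathfrak{Pr}}^{-1}(M)$ for any left $R$-module $M$.
   Context: Modules are unital left $R$-modules. ''Perfect'' means perfect on the side of the modules considered (left perfect), i.e. every flat left $R$-module is projective. A flat precover of a module $N$ is a morphism $g:F\to N$ with $F$ flat such that $\mathrm{Hom}(F',F)\to\mathrm{Hom}(F',N)$ is surjective for every flat module $F'$. The flat-precover completing domain $\mathfrak{F}^{-1}(M)$ is the class of all modules $N$ such that for every morphism $f:M\to N$ and every flat precover $g:F\to N$ there is a morphism $h:M\to F$ with $gh=f$. The subprojectivity domain $\underline{\mathfrak{Pr}}^{-1}(M)$ is the class of all modules $N$ such that for every epimorphism $g:B\to N$ and every morphism $f:M\to N$ there is a morphism $h:M\to B$ with $gh=f$. *)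

(* Defs.v *)
From HB Require Import structures.
From mathcomp Require Import all_boot all_order all_algebra.
From mathcomp Require Import generic_quotient ring_quotient.
From mathcomp Require Import boolp.
From mathcomp Require Import freeg.

Set Implicit Arguments.
Unset Strict Implicit.
Unset Printing Implicit Defensive.

Import GRing.Theory.
Local Open Scope ring_scope.
Local Open Scope quotient_scope.

(* Right R-modules are left modules over the converse ring R^c: for
   A : lmodType R^c, r : R and a : A, the right action a r is r *: a. *)

Section TensorProduct.
Variables (R : pzRingType) (A : lmodType R^c) (M : lmodType R).

Inductive tensor_rel : {freeg (A * M)%type} -> Prop :=
| tensor_rel0 : tensor_rel 0
| tensor_relB x y : tensor_rel x -> tensor_rel y -> tensor_rel (x - y)
| tensor_rel_addl a a' m :
    tensor_rel (<< (a + a', m) >> - << (a, m) >> - << (a', m) >>)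
| tensor_rel_addr a m m' :
    tensor_rel (<< (a, m + m') >> - << (a, m) >> - << (a, m') >>)
| tensor_rel_scale (r : R) a m :
    tensor_rel (<< ((r : R^c) *: a, m) >> - << (a, r *: m) >>).

Definition tensor_relb : {pred {freeg (A * M)%type}} :=
  fun x => `[< tensor_rel x >].

Fact tensor_relb_closed : zmod_closed tensor_relb.
Proof.
split; first exact/asboolP/tensor_rel0.
by move=> x y /asboolP xP /asboolP yP; apply/asboolP/tensor_relB.
Qed.

HB.instance Definition _ :=
  GRing.isZmodClosed.Build {freeg (A * M)%type} tensor_relb tensor_relb_closed.

Definition tensor : zmodType := @Quotient.quot {freeg (A * M)%type} tensor_relb.

Definition tens (a : A) (m : M) : tensor := \pi << (a, m) >>.

Definition balanced (Z : zmodType) (b : A -> M -> Z) : Prop :=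
  [/\ forall a a' m, b (a + a') m = b a m + b a' m,
      forall a m m', b a (m + m') = b a m + b a m'
    & forall (r : R) a m, b ((r : R^c) *: a) m = b a (r *: m)].

(* This is the additive map induced by b only when b is balanced. *)
Definition tensor_lift (Z : zmodType) (b : A -> M -> Z) (t : tensor) : Z :=
  fglift (fun am : A * M => b am.1 am.2 : zmodule Z) (repr t).

Lemma tens_balanced : balanced tens.
Proof.
have E (x y z : {freeg (A * M)%type}) :
    tensor_rel (x - y - z) -> \pi_tensor x = \pi y + \pi z.
  move=> xP; rewrite -raddfD; apply/eqP.
  by rewrite -Quotient.idealrBE opprD addrA; apply/asboolP.
split=> [a a' m|a m m'|r a m].
- exact/E/tensor_rel_addl.
- exact/E/tensor_rel_addr.
- by apply/eqP; rewrite -Quotient.idealrBE; apply/asboolP/tensor_rel_scale.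
Qed.

Section Lift.
Variables (Z : zmodType) (b : A -> M -> Z).
Hypothesis bP : balanced b.
Let phi := fglift (fun am : A * M => b am.1 am.2 : zmodule Z).

Let phiB x y : phi (x - y) = phi x - phi y.
Proof. exact: (lift_is_additive (fun am : A * M => b am.1 am.2 : zmodule Z)). Qed.

Let phiU a m : phi << (a, m) >> = b a m.
Proof. by rewrite /phi liftU scale1r. Qed.

Let phi_rel x : tensor_rel x -> phi x = 0.
Proof.
case: bP => bDl bDr bZ.
elim=> {x} [|x y _ IHx _ IHy|a a' m|a m m'|r a m]; rewrite ?phiB ?phiU.
- by rewrite -(subrr 0) phiB subrr.
- by rewrite IHx IHy subrr.
- by rewrite bDl addrAC addrK subrr.
- by rewrite bDr addrAC addrK subrr.
- by rewrite bZ subrr.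
Qed.

Let tensor_lift_pi x : tensor_lift b (\pi x) = phi x.
Proof.
apply/eqP; rewrite -subr_eq0; apply/eqP; rewrite -[LHS]phiB.
by apply/phi_rel/asboolP; rewrite -[asbool _]/(_ \in tensor_relb)
  Quotient.idealrBE reprK.
Qed.

Lemma tensor_lift_tens a m : tensor_lift b (tens a m) = b a m.
Proof. by rewrite tensor_lift_pi phiU. Qed.

Lemma tensor_liftB s t :
  tensor_lift b (s - t) = tensor_lift b s - tensor_lift b t.
Proof.
by rewrite -[s]reprK -[t]reprK -raddfB !tensor_lift_pi phiB.
Qed.
End Lift.

Lemma tensor_ind (P : tensor -> Prop) :
  (forall a m, P (tens a m)) -> (forall s t, P s -> P t -> P (s - t)) ->
  forall t, P t.
Proof.
move=> PU PB.
have P0 : P 0 by rewrite -(subrr (tens 0 0)); apply: PB.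
have PD s t : P s -> P t -> P (s + t).
  by move=> Ps Pt; rewrite -[t]opprK; apply/PB => //; rewrite -sub0r; apply/PB.
have PMn t n : P t -> P (t *+ n).
  by move=> Pt; elim: n => [|n IHn]; rewrite ?mulr0n // mulrS; apply: PD.
move=> t; rewrite -[t]reprK; elim/freeg_ind_dom0: (repr t).
  by rewrite raddf0.
move=> k [a m] D _ _ PDD; rewrite raddfD; apply/PD => //.
have -> : << k *g (a, m) >> = << (a, m) >> *~ k :> {freeg (A * M)%type}.
  by rewrite freegU_mulz intz.
rewrite raddfMz; case: k => n; first exact/PMn/PU.
by rewrite NegzE mulrNz -sub0r; apply/PB => //; apply/PMn/PU.
Qed.

End TensorProduct.

Definition tensor_map (R : pzRingType) (A B : lmodType R^c) (M : lmodType R)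
    (i : {linear A -> B}) : tensor A M -> tensor B M :=
  tensor_lift (fun a m => tens (i a) m).

Lemma balanced_tensor_map (R : pzRingType) (A B : lmodType R^c)
    (M : lmodType R) (i : {linear A -> B}) :
  balanced (fun (a : A) (m : M) => tens (i a) m).
Proof.
have [tDl tDr tZ] := tens_balanced B M.
by split=> [a a' m|a m m'|r a m]; rewrite ?linearD ?linearZ ?tDl ?tDr ?tZ.
Qed.

Definition flat (R : pzRingType) (M : lmodType R) : Prop :=
  forall (A B : lmodType R^c) (i : {linear A -> B}),
    injective i -> injective (tensor_map (M := M) i).

Definition epi (R : pzRingType) (B N : lmodType R) (g : {linear B -> N}) :
    Prop :=
  forall y : N, exists x : B, g x = y.

Definition projective (R : pzRingType) (P : lmodType R) : Prop :=
  forall (B N : lmodType R) (g : {linear B -> N}), epi g ->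
  forall f : {linear P -> N}, exists h : {linear P -> B}, g \o h =1 f.

Definition left_perfect (R : pzRingType) : Prop :=
  forall M : lmodType R, flat M -> projective M.

Definition flat_precover (R : pzRingType) (F N : lmodType R)
    (g : {linear F -> N}) : Prop :=
  flat F /\
  forall F' : lmodType R, flat F' ->
  forall f : {linear F' -> N}, exists h : {linear F' -> F}, g \o h =1 f.

Definition flat_precover_completing_domain (R : pzRingType) (M : lmodType R) :
    lmodType R -> Prop :=
  fun N => forall (f : {linear M -> N}) (F : lmodType R) (g : {linear F -> N}),
    flat_precover g -> exists h : {linear M -> F}, g \o h =1 f.

Definition subprojectivity_domain (R : pzRingType) (M : lmodType R) :
    lmodType R -> Prop :=
  fun N => forall (B : lmodType R) (g : {linear B -> N}), epi g ->
  forall f : {linear M -> N}, exists h : {linear M -> B}, g \o h =1 f.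

(* Main.v *)
(** Since a flat module lifts through every flat precover, condition (3) makes
    the subprojectivity domain of a flat module contain every module, which is
    projectivity. For the converse direction, free modules are flat and
    projective, and every module [N] is the image of one. A flat precover
    of [N] is therefore surjective, which gives one inclusion over any ring.
    Over a perfect ring a free module mapping onto [N] is a flat precover
    of [N], and maps into [N] which lift to it lift along every epimorphism. *)

Require Import Defs.
From HB Require Import structures.
From mathcomp Require Import all_boot all_order all_algebra.
From mathcomp Require Import boolp classical_sets functions.

Set Implicit Arguments.
Unset Strict Implicit.
Unset Printing Implicit Defensive.

Import GRing.Theory.
Local Open Scope ring_scope.

(** * Free modules as finitely supported functions *)

Section FreeModule.
Variables (R : pzRingType) (X : choiceType).

Definition finite_support : {pred X -> R^o} :=
  fun f => `[< exists s : seq X, forall x, f x != 0 -> x \in s >].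

Fact finite_support_submod_closed : submod_closed finite_support.
Proof.
split=> [|c f g /asboolP[s sP] /asboolP[t tP]]; apply/asboolP.
  by exists [::] => x; rewrite eqxx.
exists (s ++ t) => x; rewrite mem_cat; apply: contraR.
rewrite negb_or => /andP[xs xt].
have -> : (c *: f + g) x = c * f x + g x by [].
have /eqP-> : f x == 0 by apply: contraNT xs => /sP.
have /eqP-> : g x == 0 by apply: contraNT xt => /tP.
by rewrite mulr0 addr0.
Qed.

HB.instance Definition _ :=
  GRing.isSubmodClosed.Build R (X -> R^o) finite_support
    finite_support_submod_closed.

Record free_module :=
  FreeModule { coords : X -> R^o; coordsP : coords \in finite_support }.

HB.instance Definition _ := [isSub for coords].
HB.instance Definition _ := [Choice of free_module by <:].
HB.instance Definition _ := [SubChoice_isSubLmodule of free_module by <:].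

(* [coords] must land in [R^o] to inherit the module structure of functions,
   whereas a coefficient acts on modules only as an element of [R]. *)
Definition coord (f : free_module) : X -> R := coords f.
Coercion coord : free_module >-> Funclass.

Implicit Types (f : free_module) (x : X) (s : seq X).

Lemma coordD f f' x : (f + f') x = f x + f' x.
Proof. by []. Qed.

Lemma coordZ c f x : (c *: f) x = c * f x.
Proof. by []. Qed.

Lemma free_module_eqP f f' : f =1 f' -> f = f'.
Proof. by move=> ff'; apply/val_inj/funext. Qed.

(** Without repetitions a sum over [s] counts each point once. The list may exceed the support, so
    several elements can share one list. *)
Definition covers s f := uniq s /\ forall x, f x != 0 -> x \in s.

Lemma covers_exists f : exists s, covers s f.
Proof.
have /asboolP[s sP] := coordsP f.
by exists (undup s); split=> [|x /sP]; rewrite ?undup_uniq // mem_undup.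
Qed.

Fact unitv_subproof x : (fun y => (y == x)%:R : R^o) \in finite_support.
Proof.
apply/asboolP; exists [:: x] => y; rewrite inE.
by case: (y =P x) => // _; rewrite eqxx.
Qed.

Definition unitv x : free_module := FreeModule (unitv_subproof x).

Lemma coord_unitv x y : unitv x y = (y == x)%:R.
Proof. by []. Qed.

Lemma coord_sum (I : Type) (r : seq I) (F : I -> free_module) x :
  (\sum_(i <- r) F i) x = \sum_(i <- r) F i x.
Proof. by elim/big_rec2: _ => // i y z _ <-. Qed.

Lemma sum_unitv f s : covers s f -> \sum_(x <- s) f x *: unitv x = f.
Proof.
move=> [s_uniq sP]; apply: free_module_eqP => y; rewrite coord_sum.
have [ys|ys] := boolP (y \in s).
  rewrite (bigD1_seq y) // coordZ coord_unitv eqxx mulr1 big1 => [|x].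
    exact: addr0.
  by rewrite coordZ coord_unitv eq_sym => /negPf->; rewrite mulr0.
have /eqP-> : f y == 0 by apply: contraNT ys => /sP.
rewrite big_seq big1 // => x xs; rewrite coordZ coord_unitv.
by case: eqP => [yx|]; rewrite ?mulr0 //; rewrite yx xs in ys.
Qed.

Section Extension.
Variables (N : lmodType R) (g : X -> N).

(** Points outside the support contribute zero, and what remains of either list is a repetition-free
    enumeration of the support. *)
Lemma sum_covers f s s' : covers s f -> covers s' f ->
  \sum_(x <- s) f x *: g x = \sum_(x <- s') f x *: g x.
Proof.
move=> [s_uniq sP] [s'_uniq s'P].
have E t : \sum_(x <- t) f x *: g x =
           \sum_(x <- [seq x <- t | f x != 0]) f x *: g x.
  rewrite big_filter [RHS]big_mkcond; apply: eq_bigr => x _.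
  by case: eqP => //= ->; rewrite scale0r.
rewrite E [RHS]E; apply: perm_big.
apply: uniq_perm => [||x]; rewrite ?filter_uniq // !mem_filter.
by case: eqP => //= /eqP fx; rewrite sP ?s'P.
Qed.

(** The default [[::]] is never reached, by [covers_exists], and the chosen list is immaterial, by
    [sum_covers]. *)
Definition free_ext f : N := \sum_(x <- xget [::] (covers ^~ f)) f x *: g x.

Lemma free_extE f s : covers s f -> free_ext f = \sum_(x <- s) f x *: g x.
Proof.
move=> sP; apply: sum_covers => //.
exact: (@xgetPex _ [::] (covers^~ f) (covers_exists f)).
Qed.

Fact free_ext_linear : linear free_ext.
Proof.
move=> c f f'.
have [[s [_ sP]] [s' [_ s'P]]] := (covers_exists f, covers_exists f').
(* A common covering list lets the three sums be compared term by term. *)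
pose t := undup (s ++ s').
have tf : covers t f.
  by split=> [|x /sP xs]; rewrite ?undup_uniq // mem_undup mem_cat xs.
have tf' : covers t f'.
  by split=> [|x /s'P xs]; rewrite ?undup_uniq // mem_undup mem_cat xs orbT.
have tc : covers t (c *: f + f').
  split=> [|x]; first by case: tf.
  have [/tf.2 //|] := boolP (f x != 0); rewrite negbK => /eqP fx.
  have [/tf'.2 //|] := boolP (f' x != 0); rewrite negbK => /eqP f'x.
  by rewrite coordD coordZ fx f'x mulr0 addr0 eqxx.
rewrite (free_extE tf) (free_extE tf') (free_extE tc) scaler_sumr -big_split.
by apply: eq_bigr => x _; rewrite coordD coordZ scalerDl scalerA.
Qed.

HB.instance Definition _ :=
  GRing.isLinear.Build R free_module N *:%R free_ext free_ext_linear.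

Lemma free_ext_unitv x : free_ext (unitv x) = g x.
Proof.
have xP : covers [:: x] (unitv x).
  split=> // y; rewrite coord_unitv inE.
  by case: (y =P x) => // _; rewrite eqxx.
by rewrite (free_extE xP) big_seq1 coord_unitv eqxx scale1r.
Qed.

End Extension.

Lemma eq_linear_free (N : lmodType R) (g h : {linear free_module -> N}) :
  (forall x, g (unitv x) = h (unitv x)) -> g =1 h.
Proof.
move=> gh f; have [s sP] := covers_exists f.
rewrite -(sum_unitv sP) !linear_sum; apply: eq_bigr => x _.
by rewrite !linearZ gh.
Qed.

(** Preimages of the images of the basis are picked by choice and extended linearly. *)
Lemma projective_free : projective free_module.
Proof.
move=> B N g g_epi f.
have [l lP] := choice (fun x => g_epi (f (unitv x))).
exists (free_ext l); apply: (@eq_linear_free N (g \o free_ext l) f) => x /=.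
by rewrite free_ext_unitv.
Qed.

(** * Tensor products with a free module *)

Section TensorCoordinates.
Variable A : lmodType R^c.
Implicit Types t : tensor A free_module.

(** The component at [x] of the canonical map from the tensor product to the direct sum of copies of
    [A] indexed by [X]. *)
Definition tensor_coord x : tensor A free_module -> A :=
  tensor_lift (fun a f => (f x : R^c) *: a).

Lemma balanced_coord x :
  balanced (fun (a : A) (f : free_module) => (f x : R^c) *: a).
Proof.
by split=> [a a' f|a f f'|r a f]; rewrite ?scalerDr ?scalerDl ?scalerA.
Qed.

Lemma tensor_coord_tens x a f : tensor_coord x (tens a f) = (f x : R^c) *: a.
Proof. exact/tensor_lift_tens/balanced_coord. Qed.

Lemma tensor_coordB x t t' :
  tensor_coord x (t - t') = tensor_coord x t - tensor_coord x t'.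
Proof. exact/tensor_liftB/balanced_coord. Qed.

Lemma tens0l f : tens 0 f = 0 :> tensor A free_module.
Proof.
have [tDl _ _] := tens_balanced A free_module.
by apply: (addrI (tens 0 f)); rewrite -tDl !addr0.
Qed.

Lemma tensBl a a' f :
  tens (a - a') f = tens a f - tens a' f :> tensor A free_module.
Proof.
have [tDl _ _] := tens_balanced A free_module.
by apply/eqP; rewrite eq_sym subr_eq -tDl subrK.
Qed.

Lemma tens_sumr a s (F : X -> free_module) :
  tens a (\sum_(x <- s) F x) = \sum_(x <- s) tens a (F x) :> tensor A _.
Proof.
have [_ tDr _] := tens_balanced A free_module.
elim: s => [|x s IHs]; last by rewrite !big_cons tDr IHs.
by rewrite !big_nil; apply: (addrI (tens a 0)); rewrite -tDr !addr0.
Qed.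

(** For [tens a f], expand [f] in the basis and move the coefficients to [a]. Allowing every list
    above [s0] makes the claim stable under differences, where both terms need the same list. *)
Lemma tensor_sum_coord t : exists s0 : seq X,
  forall s, uniq s -> {subset s0 <= s} ->
    t = \sum_(x <- s) tens (tensor_coord x t) (unitv x).
Proof.
elim/tensor_ind: t => [a f|t t' [s0 s0P] [s0' s0'P]].
  have [s0 [_ s0P]] := covers_exists f.
  exists s0 => s s_uniq s0s.
  have sP : covers s f by split=> // x /s0P /s0s.
  rewrite -[in LHS](sum_unitv sP) tens_sumr; apply: eq_bigr => x _.
  by rewrite tensor_coord_tens; have [_ _ ->] := tens_balanced A free_module.
exists (s0 ++ s0') => s s_uniq s0s.
have s0P' : {subset s0 <= s} by move=> x xs; rewrite s0s // mem_cat xs.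
have s0'P' : {subset s0' <= s} by move=> x xs; rewrite s0s // mem_cat xs orbT.
rewrite [in LHS](s0P s) // [in LHS](s0'P s) // -sumrB.
by apply: eq_bigr => x _; rewrite tensor_coordB tensBl.
Qed.

Lemma tensor_coord_inj t t' :
  (forall x, tensor_coord x t = tensor_coord x t') -> t = t'.
Proof.
move=> tt'; apply/eqP; rewrite -subr_eq0; apply/eqP.
have [s sP] := tensor_sum_coord (t - t').
rewrite (sP (undup s)) ?undup_uniq // => [|x]; last by rewrite mem_undup.
by rewrite big1 // => x _; rewrite tensor_coordB tt' subrr tens0l.
Qed.

End TensorCoordinates.

Lemma tensor_coord_map (A B : lmodType R^c) (i : {linear A -> B}) x t :
  tensor_coord x (tensor_map i t) = i (tensor_coord x t).
Proof.
elim/tensor_ind: t => [a f|t t' IHt IHt'].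
  rewrite /tensor_map tensor_lift_tens; last exact: balanced_tensor_map.
  by rewrite !tensor_coord_tens linearZ.
rewrite /tensor_map tensor_liftB; last exact: balanced_tensor_map.
by rewrite !tensor_coordB linearB -IHt -IHt'.
Qed.

(** In coordinates [tensor_map i] acts as [i] on each component, and the coordinates separate
    tensors. *)
Lemma flat_free : flat free_module.
Proof.
move=> A B i i_inj t t' tt'; apply: tensor_coord_inj => x.
by apply: i_inj; rewrite -!tensor_coord_map tt'.
Qed.

End FreeModule.

(** * Flat precovers and the equivalence *)

Lemma epi_free_ext_id (R : pzRingType) (N : lmodType R) :
  epi (free_ext (id : N -> N)).
Proof. by move=> y; exists (unitv R y); exact: free_ext_unitv. Qed.

Lemma flat_precover_epi (R : pzRingType) (F N : lmodType R)
    (g : {linear F -> N}) : flat_precover g -> epi g.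
Proof.
move=> [_ g_lift] y.
(* The surjection from the free module on [N] factors through [g]. *)
have [h hP] := g_lift _ (@flat_free R N) (free_ext (id : N -> N)).
by exists (h (unitv R y)); rewrite [LHS]hP; exact: free_ext_unitv.
Qed.

Lemma subprojectivity_sub_completing (R : pzRingType) (M N : lmodType R) :
  subprojectivity_domain M N -> flat_precover_completing_domain M N.
Proof. by move=> MN f F g /flat_precover_epi /MN. Qed.

Lemma perfect_flat_precover_free (R : pzRingType) (N : lmodType R) :
  left_perfect R -> flat_precover (free_ext (id : N -> N)).
Proof.
move=> R_perfect; split; first exact: flat_free.
move=> F' /R_perfect F'_proj; exact/F'_proj/epi_free_ext_id.
Qed.

Theorem corollary3p5 (R : pzRingType) :
  [<-> left_perfect R;
       forall M N : lmodType R,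
         flat_precover_completing_domain M N <-> subprojectivity_domain M N;
       forall M N : lmodType R,
         flat_precover_completing_domain M N -> subprojectivity_domain M N].
Proof.
tfae=> [R_perfect M N|MN M N /MN //|MN M M_flat B N g g_epi].
  split; last exact: subprojectivity_sub_completing.
  move=> MN B g g_epi f.
  (* [f] factors as [h] followed by the free cover of [N], and the free cover lifts along [g] to
     [k]. *)
  have [h hP] := MN f _ _ (perfect_flat_precover_free N R_perfect).
  have [k kP] := projective_free g_epi (free_ext (id : N -> N)).
  by exists (k \o h) => m; rewrite -hP /= -kP.
(* Flatness of [M] is what allows [k_lift] to be applied to [f]. *)
by apply: MN g_epi => f F k [_ k_lift]; apply: k_lift.
Qed.
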